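(* In the case of dependent labels, for all $J>2$ and all $n\ge2$, there exists a nonempty subset $\tilde\Theta_{n,J}\subset\Theta^{\mathrm{dep}}$ such that for all $\theta\in\tilde\Theta_{n,J}$, $$\mathbb{P}_\theta\left(g^\star_\theta(Y_{1:n})\ne\pi_n\circ h^\star_\theta(Y_{1:n})\right)>0.$$
   Context: Model. $J\ge2$ is an integer, $\mathbb{X}=\{1,\dots,J\}$, $(\mathbb{Y},\mathcal{Y})$ is a Polish space with its Borel $\sigma$-field and $\mathcal{L}$ is a dominating measure on it. A parameter is $\theta=(\nu,Q,(f_x)_{x\in\mathbb{X}})$ with $\nu$ a probability vector on $\mathbb{X}$, $Q$ a $J\times J$ transition matrix and $f_x$ probability densities with respect to $\mathcal{L}$. Under $\mathbb{P}_\theta$ (expectation $\mathbb{E}_\theta$), $(X_i)_{i\ge1}$ is a Markov chain on $\mathbb{X}$ with initial law $\nu$ and transition matrix $Q$ and, conditionally on $(X_i)_{i\ge 1}$, the $Y_i$ are independent, $Y_i$ having density $f_{X_i}$. $Y_{1:n}=(Y_1,\dots,Y_n)$. $\Theta^{\mathrm{dep}}$ is the set of parameters (with $J$ states) for which the rows of $Q$ are not all equal. Clusterers and classifiers. $\mathcal{P}[n]$ is the set of partitions of $[n]=\{1,\dots,n\}$. An $n$-clusterer is a measurable map $g:\mathbb{Y}^n\to\mathcal{P}[n]$; an $n$-classifier is a measurable map $h=(h_1,\dots,h_n):\mathbb{Y}^n\to\mathbb{X}^n$. $\pi_n:\mathbb{X}^n\to\mathcal{P}[n]$ is $\pi_n(x_{1:n})=\{\{i:x_i=x\}:x\in\mathbb{X}\}\setminus\{\varnothing\}$,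 and $\Pi_n=\pi_n(X_{1:n})$. For partitions $A,B$ of $[n]$, $\ell(A,B)=1-\frac1n\sup_M\sum_{\{C,C'\}\in M}\mathrm{Card}(C\cap C')$, the supremum being over matchings $M$ between the blocks of $A$ and the blocks of $B$ in the complete bipartite graph (each block is in at most one edge). The Bayes clusterer $g^\star_\theta$ is the clusterer such that $g^\star_\theta(Y_{1:n})$ is the partition minimizing $g\mapsto\mathbb{E}_\theta[\ell(g(Y_{1:n}),\Pi_n)\mid Y_{1:n}]$. The (not necessarily unique) Bayes classifier $h^\star_\theta=(h^\star_{\theta,1},\dots,h^\star_{\theta,n})$ satisfies $\mathbb{P}_\theta(X_i=h^\star_{\theta,i}(Y_{1:n})\mid Y_{1:n})=\max_{x\in\mathbb{X}}\mathbb{P}_\theta(X_i=x\mid Y_{1:n})$ for $i=1,\dots,n$. *)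

(* Defs.v *)
From HB Require Import structures.
From mathcomp Require Import all_boot all_order all_algebra.
From mathcomp Require Import all_classical all_reals all_analysis.

Set Implicit Arguments.
Unset Strict Implicit.
Unset Printing Implicit Defensive.

Import Order.TTheory GRing.Theory Num.Theory.
Import numFieldNormedType.Exports.

Local Open Scope ring_scope.

(* Indices start at 0 throughout: [n] is 'I_n and the label set {1, ..., J} is
   'I_J. *)

Section Combinatorics.
Variables (J n : nat).

Definition pi_n (x : {ffun 'I_n -> 'I_J}) : {set {set 'I_n}} :=
  ([set [set i | x i == a] | a : 'I_J] :\ finset.set0)%SET.

(* An edge {C, C'} of the complete bipartite graph between the blocks of A and
   the blocks of B is encoded as the ordered pair (C, C'), so that a set
   belonging to both A and B still gives two distinct vertices. *)
Definition matching (A B : {set {set 'I_n}})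
    (M : {set {set 'I_n} * {set 'I_n}}) : bool :=
  (M \subset finset.setX A B) &&
  [forall e in M, forall e' in M,
     ((e.1 == e'.1) || (e.2 == e'.2)) ==> (e == e')].

Definition loss (R : realType) (A B : {set {set 'I_n}}) : R :=
  1 - n%:R^-1 *
      (\max_(M : {set {set 'I_n} * {set 'I_n}} | matching A B M)
         \sum_(e in M) #|(e.1 :&: e.2)%SET|)%:R.

End Combinatorics.

Local Open Scope classical_set_scope.

Definition polish (R : realType) (T : topologicalType) : Prop :=
  (exists2 D : set T, countable D & dense D) /\
  exists dist : T -> T -> R,
    [/\ forall x y, dist x y = 0 <-> x = y,
        forall x y, dist x y = dist y x,
        forall x y z, dist x z <= dist x y + dist y z,
        forall (x : T) (A : set T), nbhs x A <->
          (exists2 e, 0 < e & [set y | dist x y < e] `<=` A) &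
        forall u : nat -> T,
          (forall e, 0 < e -> exists N : nat, forall p q,
             (N <= p)%N -> (N <= q)%N -> dist (u p) (u q) < e) ->
          exists l : T, u @ \oo --> l].

Notation borel T := (g_sigma_algebraType (@open T)).

Section Model.
Variables (R : realType) (J : nat) (T : ptopologicalType).
Variable L : {measure set (borel T) -> \bar R}.

Definition prob_vector (v : 'rV[R]_J) : Prop :=
  (forall a, 0 <= v ord0 a) /\ \sum_a v ord0 a = 1.

Definition prob_density (f : borel T -> R) : Prop :=
  [/\ measurable_fun setT f,
      forall y, 0 <= f y &
      (\int[L]_y (f y)%:E = 1)%E].

Record param := Param {
  init : 'rV[R]_J;
  trans : 'M[R]_J;
  emis : 'I_J -> borel T -> R;
  initP : prob_vector init;
  transP : forall a, prob_vector (row a trans);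
  emisP : forall a, prob_density (emis a) }.

Definition Theta_dep : set param :=
  [set theta | ~ forall a b, row a (trans theta) = row b (trans theta)].

(* (X, Y) on the probability space (Omega, P) has law P_theta.  The last clause
   is the conditional independence of the Y_i given X, with densities
   f_(X_i); as k is arbitrary, and B i = setT makes the i-th factor equal to 1,
   it determines the conditional law given the whole sequence X. *)
Record is_hmm (theta : param) d (Omega : measurableType d)
    (P : probability Omega R)
    (X : nat -> Omega -> 'I_J) (Y : nat -> Omega -> borel T) : Prop := {
  hmm_measX : forall i a, measurable (X i @^-1` [set a]);
  hmm_measY : forall i, measurable_fun setT (Y i);
  hmm_init : forall a, P (X 0%N @^-1` [set a]) = (init theta ord0 a)%:E;
  hmm_markov : forall (k : nat) (x : nat -> 'I_J),
    P [set w | forall i, (i <= k.+1)%N -> X i w = x i] =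
    (P [set w | forall i, (i <= k)%N -> X i w = x i] *
       (trans theta (x k) (x k.+1))%:E)%E;
  hmm_emis : forall (k : nat) (x : nat -> 'I_J) (B : nat -> set (borel T)),
    (forall i, measurable (B i)) ->
    P [set w | forall i, (i <= k)%N -> X i w = x i /\ B i (Y i w)] =
    (P [set w | forall i, (i <= k)%N -> X i w = x i] *
       \prod_(i < k.+1) \int[L]_(y in B i) (emis theta (x i) y)%:E)%E }.

End Model.

(* phi is a version of v |-> E[Z | V = v], i.e. phi \o V is a version of
   E[Z | V]. *)
Definition is_condE (R : realType) d (Omega : measurableType d)
    (P : probability Omega R) d' (E : measurableType d')
    (V : Omega -> E) (Z : Omega -> R) (phi : E -> R) : Prop :=
  [/\ measurable_fun setT phi,
      P.-integrable setT (fun w => (phi (V w))%:E) &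
      forall B : set E, measurable B ->
        (\int[P]_(w in V @^-1` B) (phi (V w))%:E =
         \int[P]_(w in V @^-1` B) (Z w)%:E)%E].

Definition is_condP (R : realType) d (Omega : measurableType d)
    (P : probability Omega R) d' (E : measurableType d')
    (V : Omega -> E) (A : set Omega) (phi : E -> R) : Prop :=
  is_condE P V (\1_A) phi.

Section Bayes.
Variables (R : realType) (J n : nat) (T : ptopologicalType).

Definition clusterer (g : n.-tuple (borel T) -> {set {set 'I_n}}) : Prop :=
  (forall y, finset.partition (g y) [set: 'I_n]%SET) /\
  (forall A, measurable (g @^-1` [set A])).

Definition classifier (h : n.-tuple (borel T) -> {ffun 'I_n -> 'I_J}) : Prop :=
  forall x, measurable (h @^-1` [set x]).

Variables (d : measure_display) (Omega : measurableType d).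
Variable P : probability Omega R.
Variables (X : nat -> Omega -> 'I_J) (Y : nat -> Omega -> borel T).

Definition Xn (w : Omega) : {ffun 'I_n -> 'I_J} := [ffun i : 'I_n => X i w].

Definition Yn (w : Omega) : n.-tuple (borel T) := [tuple Y i w | i < n].

Definition bayes_clusterer
    (g : n.-tuple (borel T) -> {set {set 'I_n}}) : Prop :=
  clusterer g /\
  forall g', clusterer g' -> forall phi phi',
    is_condE P Yn (fun w => loss R (g (Yn w)) (pi_n (Xn w))) phi ->
    is_condE P Yn (fun w => loss R (g' (Yn w)) (pi_n (Xn w))) phi' ->
    {ae P, forall w, phi (Yn w) <= phi' (Yn w)}.

Definition bayes_classifier
    (h : n.-tuple (borel T) -> {ffun 'I_n -> 'I_J}) : Prop :=
  classifier h /\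
  forall (i : 'I_n) (phi : 'I_J -> n.-tuple (borel T) -> R) psi,
    (forall a, is_condP P Yn [set w | X i w = a] (phi a)) ->
    is_condP P Yn [set w | X i w = h (Yn w) i] psi ->
    {ae P, forall w,
       (exists a, psi (Yn w) = phi a (Yn w)) /\
       (forall a, phi a (Yn w) <= psi (Yn w))}.

End Bayes.

(* Main.v *)
(* If all states emit the same density, the observations are independent of the
   labels and both Bayes rules depend only on the law of the chain.  We take the
   stationary walk on a star: from the state 0 it jumps uniformly to one of the
   J - 1 other states, and from those it returns to 0.  Each label is 0 with
   probability 1/2 and equals any given other state with probability
   1/(2(J - 1)) < 1/2, because J > 2; so the Bayes classifier is constantly 0 and
   induces the partition with a single block.  But the walk visits 0 exactly at
   the times of one parity, so every block of the true partition lies in one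
   parity class: a matching of the true partition with the single block keeps at
   most one block, which the two parity classes also keep, together with at least
   one index of the other parity.  The parity partition therefore always has a
   loss smaller by at least 1/n. *)
Require Import Defs.
From mathcomp Require Import all_boot all_order all_algebra.
From mathcomp Require Import all_classical all_reals all_analysis.
From mathcomp Require Import ring lra.

Set Implicit Arguments.
Unset Strict Implicit.
Unset Printing Implicit Defensive.

Import Order.TTheory GRing.Theory Num.Theory.

Local Open Scope ring_scope.
Local Open Scope classical_set_scope.

(** * Random variables with finitely many values *)

Lemma measurable_forall_fin (d : measure_display) (U : measurableType d)
    (I : finType) (F : I -> set U) :
  (forall i, measurable (F i)) -> measurable [set w | forall i, F i w].
Proof.
move=> mF; rewrite (_ : [set w | _] = \big[setI/setT]_i F i).
  by apply: bigsetI_measurable => i _; exact: mF.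
apply/seteqP; split => w; rewrite -bigcap_seq => Fw i; first by move=> _.
by apply: Fw => /=; rewrite mem_index_enum.
Qed.

Section FiniteRange.
Variables (R : realType) (d : measure_display) (Omega : measurableType d).
Variable P : probability Omega R.
Variables (K : finType) (Z : Omega -> K).
Hypothesis mZ : forall k, measurable (Z @^-1` [set k]).

Lemma measurable_preimage_fin (S : set K) : measurable (Z @^-1` S).
Proof.
have -> : Z @^-1` S = \bigcup_(k in S) (Z @^-1` [set k]).
  by apply/seteqP; split => [w Sw|w [k Sk /= ->]//]; exists (Z w).
exact: fin_bigcup_measurable.
Qed.

Lemma measurable_fun_fin (F : K -> R) :
  measurable_fun setT (fun w => F (Z w)).
Proof.
by move=> _ U _; rewrite setTI; exact: (measurable_preimage_fin (F @^-1` U)).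
Qed.

(** The simple-function decomposition, from which integrability and the value of the integral follow
    by linearity. *)
Lemma EFin_sum_indic (F : K -> R) w :
  (F (Z w))%:E = (\sum_k (F k)%:E * (\1_(Z @^-1` [set k]) w)%:E)%E.
Proof.
rewrite (bigD1 (Z w))//= indicE mem_set// mule1 big1 ?adde0// => k kZ.
by rewrite indicE memNset ?mule0// => /= e; rewrite e eqxx in kZ.
Qed.

Lemma integrable_fin (D : set Omega) (F : K -> R) : measurable D ->
  P.-integrable D (fun w => (F (Z w))%:E).
Proof.
move=> mD; apply: (@integrableS _ _ _ P setT) => //.
rewrite (_ : (fun w => _) = fun w =>
    (\sum_k (F k)%:E * (\1_(Z @^-1` [set k]) w)%:E)%E).
  apply: integrable_sum => // k _; apply: integrableZl => //.
  exact: integrable_indic.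
by apply/funext => w; exact: EFin_sum_indic.
Qed.

Lemma integral_fin (D : set Omega) (F : K -> R) : measurable D ->
  (\int[P]_(w in D) (F (Z w))%:E =
   \sum_k (F k)%:E * P (D `&` Z @^-1` [set k]))%E.
Proof.
move=> mD; under eq_integral do rewrite EFin_sum_indic.
have mI k : P.-integrable D (fun w => (\1_(Z @^-1` [set k]) w)%:E).
  by apply: (@integrableS _ _ _ P setT) => //; exact: integrable_indic.
rewrite integral_sum//; last by move=> k; exact: integrableZl.
apply: eq_bigr => k _; rewrite integralZl// integral_indic//.
by rewrite setIC.
Qed.

Lemma measure_fin_sum (D : set Omega) : measurable D ->
  (P D = \sum_k P (D `&` Z @^-1` [set k]))%E.
Proof.
move=> mD; have := integral_fin (fun=> 1) mD; rewrite integral_cst// mul1e => ->.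
by under eq_bigr do rewrite mul1e.
Qed.

End FiniteRange.

(** * Independence and conditional expectation *)

Section Independence.
Variables (R : realType) (d : measure_display) (Omega : measurableType d).
Variable P : probability Omega R.

(** Conditioning on [V] freezes [G (V w)] and averages over the law of [W], which is independent of
    [V]. The posteriors and risks below are all instances, with [W] the label path and [G] the
    decision rule. *)
Lemma is_condE_indep d' (E : measurableType d') (V : Omega -> E)
    (S K : finType) (W : Omega -> S) (G : E -> K) (Psi : K -> S -> R) :
  measurable_fun setT V ->
  (forall s, measurable (W @^-1` [set s])) ->
  (forall k, measurable (G @^-1` [set k])) ->
  (forall s B, measurable B -> P (V @^-1` B `&` W @^-1` [set s]) =
                               (P (V @^-1` B) * P (W @^-1` [set s]))%E) ->
  is_condE P V (fun w => Psi (G (V w)) (W w))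
    (fun y => \sum_s fine (P (W @^-1` [set s])) * Psi (G y) s).
Proof.
move=> mV mW mG VW.
pose m k := \sum_s fine (P (W @^-1` [set s])) * Psi k s.
have mV' B : measurable B -> measurable (V @^-1` B).
  by move=> mB; rewrite -[_ @^-1` _]setTI; exact: mV.
have mGV k : measurable ((G \o V) @^-1` [set k]) by exact: (mV' _ (mG k)).
have mGVW (u : K * S) : measurable ((fun w => (G (V w), W w)) @^-1` [set u]).
  case: u => k s; rewrite (_ : _ @^-1` _ =
    (G \o V) @^-1` [set k] `&` W @^-1` [set s]); first exact: measurableI.
  by apply/seteqP; split => w /= [-> ->].
split.
- exact: (measurable_fun_fin mG m).
- exact: (integrable_fin P mGV m).
move=> B mB; rewrite (integral_fin P mGV m (mV' _ mB)).
rewrite (integral_fin P mGVW (fun u => Psi u.1 u.2) (mV' _ mB)).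
transitivity (\sum_k \sum_s (Psi k s)%:E * P (V @^-1` B `&`
    (fun w => (G (V w), W w)) @^-1` [set (k, s)]))%E; last first.
  by rewrite pair_bigA /=; apply: eq_bigr => -[].
apply: eq_bigr => k _; rewrite /m -sumEFin.
have /fineK <- : P (V @^-1` B `&` (G \o V) @^-1` [set k]) \is a fin_num.
  by apply: fin_num_measure; exact: measurableI (mV' _ mB) (mGV k).
rewrite sumEFin -EFinM mulr_suml -sumEFin; apply: eq_bigr => s _.
(* The condition on [G (V w)] is absorbed into the set for [V], so that independence applies. *)
rewrite (_ : _ `&` _ @^-1` [set (k, s)] =
    V @^-1` (B `&` G @^-1` [set k]) `&` W @^-1` [set s]); last first.
  by apply/seteqP; split => w /= [] => [? [-> ->]|[? ->] ->].
rewrite VW; last exact: measurableI.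
have /fineK <- : P (W @^-1` [set s]) \is a fin_num by exact: fin_num_measure.
rewrite (_ : V @^-1` B `&` _ = V @^-1` (B `&` G @^-1` [set k]))//.
have /fineK <- : P (V @^-1` (B `&` G @^-1` [set k])) \is a fin_num.
  by apply: fin_num_measure; apply: mV'; exact: measurableI.
by rewrite -!EFinM; congr EFin; rewrite /=; ring.
Qed.

(** Pi-lambda argument: rectangles are stable under intersection and generate the product
    sigma-algebra, while the sets [B] satisfying the product formula form a Dynkin class. *)
Lemma tuple_rectangle_indep d' (U : measurableType d') n
    (V : Omega -> n.-tuple U) (A : set Omega) :
  measurable_fun setT V -> measurable A ->
  (forall C : 'I_n -> set U, (forall i, measurable (C i)) ->
    P ([set w | forall i, C i (tnth (V w) i)] `&` A) =
    (P [set w | forall i, C i (tnth (V w) i)] * P A)%E) ->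
  forall B, measurable B -> P (V @^-1` B `&` A) = (P (V @^-1` B) * P A)%E.
Proof.
move=> mV mA VA B mB.
pose G := [set D : set (n.-tuple U) | exists2 C : 'I_n -> set U,
  (forall i, measurable (C i)) & D = [set y | forall i, C i (tnth y i)]].
have mG : measurable = <<s G >>.
  apply/seteqP; split.
    apply: smallest_sub; first exact: smallest_sigma_algebra.
    move=> D; rewrite -bigcup_seq => -[i /= _ [C mC <-]].
    apply: sub_sigma_algebra.
    (* A one-coordinate cylinder is a rectangle whose other sides are full. *)
    exists (fun j => if j == i then C else setT) => [j|]; first by case: ifP.
    rewrite setTI; apply/seteqP; split => [y Cy j|y /(_ i)]; last by rewrite eqxx.
    by case: eqP => // ->.
  apply: smallest_sub; first exact: sigma_algebra_measurable.
  move=> _ [C mC ->].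
  apply: (@measurable_forall_fin _ _ _ (fun i y => C i (tnth y i))) => i.
  by rewrite -[X in measurable X]setTI; exact: measurable_tnth.
have GI : setI_closed G.
  move=> _ _ [C mC ->] [D mD ->]; exists (fun i => C i `&` D i).
    by move=> i; exact: measurableI.
  by apply/seteqP; split => [y [Cy Dy] i|y CDy]; split => // i; have [] := CDy i.
have mV' D : measurable D -> measurable (V @^-1` D).
  by move=> mD; rewrite -[_ @^-1` _]setTI; exact: mV.
move: B mB; rewrite mG; apply: dynkin_induction => //.
- by rewrite preimage_setT setTI probability_setT mul1e.
- by move=> _ [C mC ->]; exact: VA.
- move=> S mS VS; rewrite (_ : V @^-1` (~` S) = ~` (V @^-1` S))// setIC -setDE.
  rewrite measureD//; last 2 first.
    exact: mV'.
    by rewrite (le_lt_trans (probability_le1 P mA))// ltry.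
  rewrite [A `&` _]setIC [X in (_ - X)%E]VS probability_setC; last exact: mV'.
  have /fineK <- : P A \is a fin_num by exact: fin_num_measure.
  have /fineK <- : P (V @^-1` S) \is a fin_num.
    by apply: fin_num_measure; exact: mV'.
  rewrite -[X in (X - _)%E](@fineK _ (P A)) ?fin_num_measure//.
  by rewrite -EFinM -!EFinB -EFinM mulrBl mul1r.
- move=> F mF tF VF; rewrite preimage_bigcup setI_bigcupl.
  have tVF : trivIset setT (fun k => V @^-1` F k).
    apply/trivIsetP => i j _ _ ij.
    by move/trivIsetP : tF => /(_ i j I I ij); rewrite -preimage_setI => ->;
      rewrite preimage_set0.
  rewrite measure_bigcup//=; last 2 first.
    by move=> k _; exact: measurableI (mV' _ (mF k)) mA.
    exact: trivIset_setIr.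
  rewrite measure_bigcup//; last by move=> k _; exact: mV'.
  have /fineK <- : P A \is a fin_num by exact: fin_num_measure.
  rewrite muleC -nneseriesZl//.
  by apply: eq_eseriesr => k _; rewrite VF muleC fineK// fin_num_measure.
Qed.
End Independence.

(** * Hidden Markov models: transitions, support, and independence under a common emission
    density *)

Section HiddenMarkov.
Variables (R : realType) (T : ptopologicalType).
Variables (L : {measure set (borel T) -> \bar R}) (J : nat).
Variables (theta : param J L) (d : measure_display) (Omega : measurableType d).
Variables (P : probability Omega R) (X : nat -> Omega -> 'I_J).
Variables (Y : nat -> Omega -> borel T).
Hypothesis XY : is_hmm theta P X Y.

Lemma measurable_Yn n : measurable_fun setT (Yn n Y).
Proof.
apply/measurable_fun_tnthP => i.
rewrite (_ : _ \o _ = Y i); first exact: (hmm_measY XY).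
by apply/funext => w; rewrite /= tnth_mktuple.
Qed.

(** Translates to the paths indexed by [nat] of [hmm_markov] and [hmm_emis]; the values of [inord]
    above [k] never enter. *)
Lemma preimage_Xn k (x : {ffun 'I_k.+1 -> 'I_J}) :
  Xn k.+1 X @^-1` [set x] =
  [set w | forall i, (i <= k)%N -> X i w = x (inord i)].
Proof.
apply/seteqP; split => w /=.
  by move=> <- i ik; rewrite ffunE inordK.
move=> Xx; apply/ffunP => i; rewrite ffunE Xx ?inord_val//.
by rewrite -ltnS.
Qed.

Lemma measurable_Xn n x : measurable (Xn n X @^-1` [set x]).
Proof.
rewrite (_ : _ @^-1` _ = [set w | forall i : 'I_n, X i w = x i]).
  by apply: measurable_forall_fin => i; exact: (hmm_measX XY i (x i)).
apply/seteqP; split => w /=; first by move=> <- i; rewrite ffunE.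
by move=> Xx; apply/ffunP => i; rewrite ffunE.
Qed.

(** [hmm_markov] speaks of whole paths only, so both sides are summed over the paths up to time [k];
    those not ending in [a] contribute 0. *)
Lemma hmm_step k a b :
  P (X k @^-1` [set a] `&` X k.+1 @^-1` [set b]) =
  (P (X k @^-1` [set a]) * (trans theta a b)%:E)%E.
Proof.
have mX := hmm_measX XY; have mXn := @measurable_Xn k.+1.
rewrite (measure_fin_sum P mXn (measurableI _ _ (mX k a) (mX k.+1 b))).
rewrite (measure_fin_sum P mXn (mX k a)) ge0_sume_distrl//.
apply: eq_bigr => x _; rewrite preimage_Xn.
have [xa|xa] := eqVneq (x (inord k)) a; last first.
  rewrite (_ : _ `&` _ `&` _ = set0); last first.
    by apply/seteqP; split => // w [[/= Xa _] /(_ k (leqnn k))];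
      rewrite Xa => /esym/eqP; rewrite (negbTE xa).
  rewrite (_ : _ `&` _ = set0) ?measure0 ?mul0e//.
  by apply/seteqP; split => // w [/= Xa /(_ k (leqnn k))];
    rewrite Xa => /esym/eqP; rewrite (negbTE xa).
(* The path [x] prolonged by [b] at time [k.+1]. *)
pose z i := if i == k.+1 then b else x (inord i).
have zE i : (i <= k)%N -> z i = x (inord i).
  by rewrite /z; case: eqP => // ->; rewrite ltnn.
have zb : z k.+1 = b by rewrite /z eqxx.
have := hmm_markov XY k z; rewrite (zE k)// xa zb.
rewrite (_ : [set w | _] = X k @^-1` [set a] `&` X k.+1 @^-1` [set b] `&`
   [set w | forall i, (i <= k)%N -> X i w = x (inord i)]); last first.
  apply/seteqP; split => w.
    move=> Xz; split; first split => /=.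
    - by rewrite Xz ?zE ?xa.
    - by rewrite Xz// /z eqxx.
    by move=> i ik; rewrite Xz ?zE// (leq_trans ik).
  move=> [[_ Xb] Xx] i; rewrite leq_eqVlt => /orP[/eqP->|ik].
    by rewrite /z eqxx.
  by rewrite Xx ?zE.
move=> ->; congr (P _ * _)%E; apply/seteqP; split => w.
  by move=> Xz; split => [|i ik]; rewrite /= Xz// zE.
by move=> [_ Xx] i ik; rewrite Xx// zE.
Qed.

Lemma hmm_marginal_succ k b :
  P (X k.+1 @^-1` [set b]) =
  (\sum_a P (X k @^-1` [set a]) * (trans theta a b)%:E)%E.
Proof.
rewrite (measure_fin_sum P (hmm_measX XY k) (hmm_measX XY k.+1 b)).
by apply: eq_bigr => a _; rewrite setIC hmm_step.
Qed.

(** The path event lies inside the event of one of its transitions, which is null when the matrix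
    entry vanishes. *)
Lemma hmm_support n (x : {ffun 'I_n -> 'I_J}) (i j : 'I_n) :
  P (Xn n X @^-1` [set x]) != 0%E -> j = i.+1 :> nat ->
  trans theta (x i) (x j) != 0.
Proof.
move=> Px ji; apply: contra_neq Px => Q0.
apply/eqP; rewrite -measure_le0.
apply: (@le_trans _ _ (P (X i @^-1` [set x i] `&` X i.+1 @^-1` [set x j]))).
  apply: le_measure; rewrite ?inE.
  - exact: measurable_Xn.
  - by apply: measurableI; exact: (hmm_measX XY).
  by move=> w /= <-; rewrite !ffunE ji.
by rewrite hmm_step Q0 mule0.
Qed.

Hypothesis emis_const : forall a b, emis theta a = emis theta b.

(** With a common density, the product in [hmm_emis] is the same number [c] for every label path. *)
Lemma hmm_indep k (x : {ffun 'I_k.+1 -> 'I_J}) B : measurable B ->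
  P (Yn k.+1 Y @^-1` B `&` Xn k.+1 X @^-1` [set x]) =
  (P (Yn k.+1 Y @^-1` B) * P (Xn k.+1 X @^-1` [set x]))%E.
Proof.
apply: tuple_rectangle_indep => [||C mC].
- exact: measurable_Yn.
- exact: measurable_Xn.
pose D := [set w | forall i, C i (tnth (Yn k.+1 Y w) i)].
(* The label [x ord0] is an arbitrary choice, since all densities agree. *)
pose c := (\prod_(i < k.+1) \int[L]_(y in C i) (emis theta (x ord0) y)%:E)%E.
have mXn := @measurable_Xn k.+1.
have mD : measurable D.
  apply: measurable_forall_fin => i.
  rewrite (_ : (fun w => _) = Y i @^-1` C i).
    by rewrite -[X in measurable X]setTI; exact: (hmm_measY XY).
  by apply/funext => w; rewrite tnth_mktuple.
have Dx z : P (D `&` Xn k.+1 X @^-1` [set z]) =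
             (P (Xn k.+1 X @^-1` [set z]) * c)%E.
  have := hmm_emis XY k (fun i => z (inord i)) (fun i => mC (inord i)).
  rewrite (_ : [set w | _] = D `&` Xn k.+1 X @^-1` [set z]); last first.
    rewrite preimage_Xn; apply/seteqP; split => w.
      move=> XYz; split => [i|i ik].
        have := (XYz i); rewrite -ltnS ltn_ord inord_val tnth_mktuple.
        by case.
      by have [] := XYz i ik.
    move=> [Dw Xz] i ik; split; first exact: Xz.
    by have := Dw (inord i); rewrite tnth_mktuple inordK.
  rewrite preimage_Xn => ->; congr (_ * _)%E.
  apply: eq_bigr => i _; rewrite inord_val.
  by rewrite (emis_const (z i) (x ord0)).
(* Summing [Dx] over all label paths, whose probabilities add up to 1, identifies [c]. *)
have -> : P D = c.
  rewrite (measure_fin_sum P mXn mD); under eq_bigr do rewrite Dx.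
  rewrite -ge0_sume_distrl//.
  have := measure_fin_sum P mXn measurableT.
  under eq_bigr do rewrite setTI.
  by rewrite probability_setT => <-; rewrite mul1e.
by rewrite Dx muleC.
Qed.

End HiddenMarkov.

(** * Partitions induced by labels, and their losses *)

Section Partitions.
Variables (J n : nat).
Implicit Types x p : {ffun 'I_n -> 'I_J}.

Let block x i := [set j | x j == x i]%SET.

Lemma block_neq x i j : x i != x j -> block x i != block x j.
Proof.
by apply: contra => /eqP/setP/(_ i); rewrite !inE eqxx => /esym.
Qed.

(** Indexing the blocks by their elements instead of their labels leaves no empty block to
    remove. *)
Lemma pi_nE x : pi_n x = [set block x i | i : 'I_n]%SET.
Proof.
apply/setP => C; rewrite !inE; apply/andP/imsetP.
  move=> [C0 /imsetP[a _ Ca]]; rewrite {}Ca in C0 *.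
  by have /set0Pn[i] := C0; rewrite inE => /eqP <-; exists i.
move=> [i _ ->]; split; last by apply/imsetP; exists (x i).
by apply/set0Pn; exists i; rewrite inE.
Qed.

Lemma pi_n_partition x : finset.partition (pi_n x) [set: 'I_n]%SET.
Proof.
rewrite (_ : pi_n x = preim_partition x [set: 'I_n]%SET).
  exact: preim_partitionP.
rewrite pi_nE; apply/setP => C.
by apply/imsetP/imsetP => -[i _ ->]; exists i => //; apply/setP => j;
  rewrite !inE eq_sym.
Qed.

(** Here [x] refines [p], and [p] has at least two blocks. One more matched index lowers the loss by
    [n%:R^-1], so it suffices to compare the maximal overlaps as integers. *)
Lemma loss_const_gt (R : realType) (c : 'I_J) x p : (0 < n)%N ->
  (forall i j, x i = x j -> p i = p j) -> (forall i, exists j, p i != p j) ->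
  loss R (pi_n p) (pi_n x) + n%:R^-1 <= loss R (pi_n [ffun=> c]) (pi_n x).
Proof.
move=> n0 xp pp; rewrite /loss.
set s1 := (X in 1 - _ * X%:R + _); set s2 := (X in _ <= _ - _ * X%:R).
suff s21 : (s2 < s1)%N.
  have s21R : s2%:R + 1 <= s1%:R :> R by rewrite natr1 ler_nat.
  have n1 : 0 <= n%:R^-1 :> R by rewrite invr_ge0.
  have := ler_wpM2l n1 s21R; rewrite mulrDr mulr1; lra.
(* Two edges: the first keeps all of [block x i], which lies in [block p i]; the second keeps at
   least an index [j] with another [p]-label. *)
have key i : (#|block x i| < s1)%N.
  have [j pij] := pp i.
  pose M := [set (block p i, block x i); (block p j, block x j)]%SET.
  have xij : x i != x j by apply: contra pij => /eqP/xp ->.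
  have mM : matching (pi_n p) (pi_n x) M.
    apply/andP; split.
      by apply/fintype.subsetP => e /set2P[]->;
        rewrite finset.in_setX !pi_nE !imset_f.
    have pN := block_neq pij; have xN := block_neq xij.
    apply/forall_inP => e /set2P[]->; apply/forall_inP => e' /set2P[]->;
      apply/implyP; rewrite /= ?eqxx //.
      by rewrite (negbTE pN) (negbTE xN).
    by rewrite eq_sym (negbTE pN) eq_sym (negbTE xN).
  apply: leq_trans (leq_bigmax_cond _ mM).
  rewrite big_setU1 ?big_set1 /=; last first.
    rewrite inE xpair_eqE negb_and; apply/orP; left.
    exact: block_neq.
  rewrite (_ : _ :&: _ = block x i)%SET; last first.
    by apply/finset.setIidPr/fintype.subsetP => l; rewrite !inE => /eqP/xp ->.
  rewrite -addn1 leq_add2l card_gt0; apply/set0Pn; exists j.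
  by rewrite !inE !eqxx.
have blkT : pi_n [ffun=> c] = [set [set: 'I_n]]%SET.
  rewrite pi_nE; apply/setP => C; rewrite inE; apply/imsetP/eqP => [[i _ ->]|->].
    by apply/setP => j; rewrite !inE !ffunE eqxx.
  exists (Ordinal n0) => //.
  by apply/setP => j; rewrite !inE !ffunE eqxx.
(* [s2] is a maximum, so every matching is bounded separately; [key] also gives [0 < s1] for the
   default value. *)
apply: (big_ind (fun m => (m < s1)%N)) => [||M].
- exact: leq_trans (key (Ordinal n0)).
- by move=> a b; rewrite gtn_max => -> ->.
rewrite blkT => /andP[/fintype.subsetP MX /forall_inP Minj].
have [->|/set0Pn[e eM]] := eqVneq M finset.set0.
  by rewrite big_set0; exact: leq_trans (key (Ordinal n0)).
have eT e' : e' \in M -> e'.1 = [set: 'I_n]%SET.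
  by move=> /MX; rewrite inE => /andP[/set1P].
have /MX : e \in M by [].
rewrite inE pi_nE => /andP[_ /imsetP[i _ ei]].
(* All edges share the single block as first vertex, so there is only one. *)
rewrite (_ : M = [set e]%SET); last first.
  apply/setP => e'; rewrite inE; apply/idP/eqP => [e'M|->//].
  apply/eqP; rewrite eq_sym; move: Minj => /(_ e eM)/forall_inP/(_ e' e'M).
  by rewrite !eT// eqxx.
by rewrite big_set1 eT// finset.setTI ei; exact: key.
Qed.

End Partitions.

(** * The stationary walk on a star and its Bayes rules *)

Section StarChain.
Variables (R : realType) (m : nat).

(** Writing [J] as [m.+3] leaves [m.+2] leaves around the hub [ord0], hence at least two. *)
Definition star_trans : 'M[R]_m.+3 := \matrix_(a, b)
  if a == ord0 then (b != ord0)%:R / m.+2%:R else (b == ord0)%:R.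

(** Each state is weighted by its degree in the star, normalised. *)
Definition star_init : 'rV[R]_m.+3 := \row_b
  if b == ord0 then 2^-1 else (2 * m.+2%:R)^-1.

Lemma star_trans_prob a : prob_vector (row a star_trans).
Proof.
split=> [b|].
  by rewrite !mxE; case: ifP => _; rewrite ?divr_ge0.
under eq_bigr do rewrite !mxE.
rewrite big_ord_recl /=; case: ifP => _.
  rewrite mul0r add0r (eq_bigr (fun=> m.+2%:R^-1)) => [|i _]; last first.
    by rewrite mul1r.
  by rewrite sumr_const card_ord -[LHS]mulr_natl mulfV.
by rewrite big1 ?addr0.
Qed.

Lemma star_init_prob : prob_vector star_init.
Proof.
split=> [b|]; first by rewrite mxE; case: ifP => _; rewrite invr_ge0.
under eq_bigr do rewrite !mxE.
rewrite big_ord_recl /= sumr_const card_ord -mulr_natl.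
by field; rewrite -natrD pnatr_eq0.
Qed.

Lemma star_init_stationary b :
  \sum_a star_init ord0 a * star_trans a b = star_init ord0 b.
Proof.
rewrite big_ord_recl /= !mxE /=.
under eq_bigr do rewrite !mxE /=.
rewrite sumr_const card_ord -mulr_natl; case: eqP => _ /=;
  by field; rewrite -?natrD ?pnatr_eq0.
Qed.

(** This is where [J > 2] enters, as [1 < m.+2]. Strictness makes [ord0] the only maximizer, so that
    the Bayes classifier is determined almost everywhere. *)
Lemma star_init_max a : a != ord0 -> star_init ord0 a < star_init ord0 ord0.
Proof.
move=> a0; rewrite !mxE eqxx (negbTE a0) ltf_pV2 ?posrE//.
by rewrite ltr_pMr// ltr1n.
Qed.

Lemma star_trans_neq0 a b :
  star_trans a b != 0 -> (b == ord0) = (a != ord0).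
Proof.
rewrite mxE; case: ifP => _; case: (b == ord0) => //=.
- by rewrite mul0r eqxx.
- by rewrite eqxx.
Qed.

Variables (T : ptopologicalType) (L : {measure set (borel T) -> \bar R}).
Variables (f : borel T -> R) (fL : prob_density L f).

Definition star_param : param m.+3 L :=
  Param star_init_prob star_trans_prob (fun=> fL).

Lemma star_param_dep : Theta_dep star_param.
Proof.
(* The hub column has entry 0 in the row of the hub and 1 in that of a leaf. *)
move=> /(_ ord0 ord_max)/rowP/(_ ord0)/eqP; apply/negP.
by rewrite !mxE /= mul0r eq_sym oner_eq0.
Qed.

Variables (d : measure_display) (Omega : measurableType d).
Variables (P : probability Omega R) (X : nat -> Omega -> 'I_m.+3).
Variables (Y : nat -> Omega -> borel T).
Hypothesis XY : is_hmm star_param P X Y.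

Lemma star_marginal k a : P (X k @^-1` [set a]) = (star_init ord0 a)%:E.
Proof.
elim: k a => [|k IH] a; first exact: (hmm_init XY).
rewrite (hmm_marginal_succ XY) -star_init_stationary -sumEFin.
by apply: eq_bigr => b _; rewrite IH EFinM.
Qed.

(** Every transition of nonzero probability exchanges hub and leaves, so being at the hub flips at
    each step. *)
Lemma star_support_alternates n (x : {ffun 'I_n.+1 -> 'I_m.+3}) i :
  P (Xn n.+1 X @^-1` [set x]) != 0%E ->
  (x i == ord0) = (x ord0 == ord0) (+) odd i.
Proof.
move=> Px; case: i => i; elim: i => [|i IH] i_n.
  by rewrite addbF; congr (x _ == _); exact: val_inj.
have /star_trans_neq0 -> := hmm_support XY (i := Ordinal (ltnW i_n))
  (j := Ordinal i_n) Px erefl.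
by rewrite IH /= addbN.
Qed.

Variable k : nat.
Let n := k.+2.

(** Only the induced partition matters: it is the same whether the walk visits the hub at even or at
    odd times, so it requires no knowledge of the starting state. *)
Definition parity : {ffun 'I_n -> 'I_m.+3} :=
  [ffun i : 'I_n => inord (odd i)].

Lemma parity_eq (i j : 'I_n) : (parity i == parity j) = (odd i == odd j).
Proof.
rewrite !ffunE -val_eqE /= !inordK; last 2 first.
- by case: odd.
- by case: odd.
by do 2 case: odd.
Qed.

Lemma star_loss_gt x : P (Xn n X @^-1` [set x]) != 0%E ->
  loss R (pi_n parity) (pi_n x) + n%:R^-1 <=
  loss R (pi_n ([ffun=> ord0] : {ffun 'I_n -> 'I_m.+3})) (pi_n x).
Proof.
move=> Px; apply: loss_const_gt => // [i j xij|i].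
  apply/eqP; rewrite parity_eq; apply/eqP.
  have := star_support_alternates i Px.
  by rewrite xij (star_support_alternates j Px) => /addbI ->.
(* An index of the other parity; index 1 exists because [n] is [k.+2]. *)
exists (if odd i then ord0 else inord 1).
by rewrite parity_eq; case: ifP => _; rewrite ?inordK.
Qed.

(** The left side is the form in which [is_condE_indep] delivers the posterior probability of a
    label. *)
Lemma star_marginal_sum (i : 'I_n) a :
  \sum_x fine (P (Xn n X @^-1` [set x])) * (x i == a)%:R = star_init ord0 a.
Proof.
apply: EFin_inj; rewrite -(star_marginal i) -sumEFin.
rewrite (measure_fin_sum P (measurable_Xn XY (n := n))
  (hmm_measX XY i a)).
apply: eq_bigr => x _; rewrite EFinM fineK ?fin_num_measure//; last first.
  exact: (measurable_Xn XY).
have [<-|xa] := eqVneq (x i) a.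
  rewrite mule1; congr (P _); apply/seteqP; split => w /=; last by case.
  by move=> <-; rewrite ffunE.
rewrite mule0 (_ : _ `&` _ = set0) ?measure0//; apply/seteqP; split => // w.
by case=> /= Xa Xx; move: xa; rewrite -Xx ffunE Xa eqxx.
Qed.

Lemma star_bayes_ne g h :
  bayes_clusterer P X Y g -> bayes_classifier P X Y h ->
  (0 < P [set w | g (Yn n Y w) <> pi_n (h (Yn n Y w))])%E.
Proof.
move=> [[gpart mg] gmin] [mh hmax].
have mYn := measurable_Yn XY (n := n).
have mXn x := measurable_Xn XY (n := n) x.
have ind := hmm_indep XY (fun _ _ => erefl) (k := k.+1).
rewrite lt0e measure_ge0 andbT; apply/eqP => N0.
(* An almost-everywhere statement needs a measurable exceptional set; here it is the preimage of a
   set of values of the finite-range pair [(g, h)]. *)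
have gh : {ae P, forall w, g (Yn n Y w) = pi_n (h (Yn n Y w))}.
  exists [set w | g (Yn n Y w) <> pi_n (h (Yn n Y w))]; split => //.
  have mgh u : measurable ((fun y => (g y, h y)) @^-1` [set u]).
    case: u => C x; rewrite (_ : _ @^-1` _ =
      g @^-1` [set C] `&` h @^-1` [set x]); first exact: measurableI.
    by apply/seteqP; split => y /= [-> ->].
  rewrite -[X in measurable X]setTI; apply: (mYn measurableT (
    (fun y => (g y, h y)) @^-1` [set u | u.1 <> pi_n u.2])).
  exact: (measurable_preimage_fin mgh [set u | u.1 <> pi_n u.2]).
have h0 i : {ae P, forall w, h (Yn n Y w) i = ord0}.
  pose p a := \sum_x fine (P (Xn n X @^-1` [set x])) * (x i == a)%:R.
  have H1 a : is_condP P (Yn n Y) [set w | X i w = a] (fun=> p a).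
    rewrite /is_condP (_ : \1_ _ = fun w => (Xn n X w i == a)%:R); last first.
      apply/funext => w; rewrite indicE ffunE; congr (nat_of_bool _)%:R.
      by apply/idP/eqP => [/set_mem//|]; exact: mem_set.
    exact: (is_condE_indep (fun _ (x : {ffun _ -> _}) => (x i == a)%:R)
      mYn mXn mh ind).
  have H2 : is_condP P (Yn n Y) [set w | X i w = h (Yn n Y w) i]
      (fun y => p (h y i)).
    rewrite /is_condP
      (_ : \1_ _ = fun w => (Xn n X w i == h (Yn n Y w) i)%:R); last first.
      apply/funext => w; rewrite indicE ffunE; congr (nat_of_bool _)%:R.
      by apply/idP/eqP => [/set_mem//|]; exact: mem_set.
    exact: (is_condE_indep (fun c x : {ffun _ -> _} => (x i == c i)%:R)
      mYn mXn mh ind).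
  apply: filterS (hmax i _ _ H1 H2) => w [_ /(_ ord0)] /=.
  (* Any label other than [ord0] would have a strictly smaller posterior probability. *)
  rewrite /p !star_marginal_sum; apply: contraPP => /eqP hi.
  by apply/negP; rewrite -ltNge; exact: star_init_max.
have g0 : {ae P, forall w, g (Yn n Y w) =
    pi_n ([ffun=> ord0] : {ffun 'I_n -> 'I_m.+3})}.
  apply: filterS2 gh (filter_forall _ h0) => w -> h0w; congr pi_n.
  by apply/ffunP => i; rewrite ffunE.
(* The competitor ignores the data and always answers the parity partition. *)
pose A (_ : n.-tuple (borel T)) := pi_n parity.
have clA : clusterer A.
  split=> [y|C]; first exact: pi_n_partition.
  have [<-|AC] := pselect (pi_n parity = C).
    by rewrite (_ : _ @^-1` _ = setT)//; apply/seteqP; split.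
  by rewrite (_ : _ @^-1` _ = set0)//; apply/seteqP; split.
pose Psi C (x : {ffun 'I_n -> 'I_m.+3}) := loss R C (pi_n x).
have := gmin A clA _ _
  (is_condE_indep Psi mYn mXn mg ind) (is_condE_indep Psi mYn mXn clA.2 ind).
move=> le_ae.
have psum : \sum_x fine (P (Xn n X @^-1` [set x])) = 1.
  rewrite sum_fine => [|x _]; last exact: fin_num_measure.
  have := measure_fin_sum P mXn measurableT.
  by under eq_bigr do rewrite setTI; rewrite probability_setT => <-.
(* Averaged over label paths, the risk of the single block exceeds that of [A] by at least
   [n%:R^-1], against the optimality of [g]. Paths of probability 0, where [star_loss_gt] does not
   apply, have weight 0. *)
have [B [mB PB0 sub]] : {ae P, forall w, False}.
  apply: filterS2 le_ae g0 => w; rewrite /A => /[swap] ->; apply/negP.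
  rewrite -ltNge; apply: (@lt_le_trans _ _
    (\sum_x fine (P (Xn n X @^-1` [set x])) * (Psi (pi_n parity) x + n%:R^-1))).
    under [ltRHS]eq_bigr do rewrite mulrDr.
    by rewrite big_split /= -mulr_suml psum mul1r ltrDl invr_gt0.
  apply: ler_sum => x _.
  have [->|Px] := eqVneq (P (Xn n X @^-1` [set x])) 0%E.
    by rewrite !mul0r.
  by rewrite ler_wpM2l ?fine_ge0// star_loss_gt.
suff : P setT = 0%E by rewrite probability_setT => /eqP; rewrite onee_eq0.
apply/eqP; rewrite -measure_le0 -PB0; apply: le_measure; rewrite ?inE//.
by move=> w _; apply: sub => /=.
Qed.

End StarChain.

Theorem theorem10 (R : realType) (T : ptopologicalType) (hT : polish R T)
    (L : {measure set (borel T) -> \bar R})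
    (hL : exists f, prob_density L f)
    (J n : nat) (hJ : (2 < J)%N) (hn : (2 <= n)%N) :
  exists Theta_tilde : set (param J L),
    [/\ Theta_tilde !=set0,
        Theta_tilde `<=` @Theta_dep R J T L &
        forall theta, Theta_tilde theta ->
        forall (d : measure_display) (Omega : measurableType d)
          (P : probability Omega R)
          (X : nat -> Omega -> 'I_J) (Y : nat -> Omega -> borel T),
        is_hmm theta P X Y ->
        forall (g : n.-tuple (borel T) -> {set {set 'I_n}})
          (h : n.-tuple (borel T) -> {ffun 'I_n -> 'I_J}),
        bayes_clusterer P X Y g ->
        bayes_classifier P X Y h ->
        (0 < P [set w | g (Yn n Y w) <> pi_n (h (Yn n Y w))])%E].
Proof.
case: hL => f fL; case: J hJ => [|[|[|m]]]// _; case: n hn => [|[|k]]// _.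
(* A singleton suffices, with any density [f] shared by all states. *)
exists [set star_param m fL]; split; first by exists (star_param m fL).
- by move=> _ ->; exact: star_param_dep.
- move=> _ -> d Omega P X Y XY g h; exact: (star_bayes_ne XY).
Qed.
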